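(* Let $G \rightrightarrows M$ be a Lie groupoid with Lie algebroid $A\to M$, let $\Delta$ be a representation of $G$ on a trivializable real line bundle $L\to M$, and let $\sigma\in\Gamma(L)$ be any fixed nonvanishing section. Let $\phi_\sigma \in C^\infty(G;\mathbb{R}^\times)$ be the characteristic function of $(L,\Delta,\sigma)$, let $\nabla$ be the induced representation of $A$ on $L$, and let $\theta_\sigma\in\Gamma(A^* )$ be defined by $\theta_\sigma(X)\,\sigma=\nabla_X\sigma$ for $X\in\Gamma(A)$. Then the van Est map $V$ sends $\phi_\sigma$ to $\theta_\sigma$, i.e. $V\phi_\sigma=\theta_\sigma$.
   Context: $s,t\colon G\to M$ are the source and target maps, and $1_x\in G$ is the unit at $x\in M$. A representation $\Delta$ of $G$ on $L$ assigns to each $g\in G$ a linear isomorphism $\Delta_g\colon L_{s(g)}\to L_{t(g)}$, smooth in $g$, with $\Delta_{gh}=\Delta_g\Delta_h$ whenever $s(g)=t(h)$. The characteristic function is defined by $\Delta_g\sigma_{s(g)}=\phi_\sigma(g)\,\sigma_{t(g)}$. Lie algebroid conventions: the fiber $A_x$ is the space of vectors in $T_{1_x}G$ tangent to the $s$-fiber through $1_x$, and the anchor $\rho\colon A\to TM$ is the restriction of $dt$. For $X\in\Gamma(A)$, $\bar X$ denotes the associated vector field along the submanifold of units of $G$, tangent to the $s$-fibers. Van Est map on $1$-cochains: for a smooth $\psi\colon G\to\mathbb{R}^\times$ with $\psi(1_x)=1$ for all $x\in M$, $V\psi\in\Gamma(A^* )$ is given by $V\psi(X)=\bar X(\log\psi)=\bar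 X(\psi)$ for $X\in\Gamma(A)$, a function on $M$ (the derivatives being taken at units). Induced representation $\nabla\colon\Gamma(A)\times\Gamma(L)\to\Gamma(L)$: use $\sigma$ to identify $L$ with $M\times\mathbb{R}$ and $\Gamma(L)$ with $C^\infty(M)$ via $f\sigma\mapsto f$, so that $\Delta_g(s(g),r)=(t(g),\phi_\sigma(g)r)$. Given $a\in A_x$, choose a smooth path $\gamma_u$ in $G$, $u\in[0,\epsilon)$, with $\gamma_0=1_x$, $s(\gamma_u)=x$ for all $u$, and $\frac{d}{du}\big|_{u=0}\gamma_u=a$. Then $\nabla_a f\in\mathbb{R}$ is determined for $f\in C^\infty(M)$ by $$\frac{d}{du}\Big|_{u=0}\Delta_{\gamma_u}(x,f(x))=\big(\rho(a),\,-D_{\rho(a)}f+\nabla_a f\big),$$ where $D_{\rho(a)}f$ is the directional derivative of $f$ at $x$ in the direction $\rho(a)$, and $(\nabla_X f)(x)=\nabla_{X_x}f$ for $X\in\Gamma(A)$. *)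

(* Defs.v *)
From HB Require Import structures.
From mathcomp Require Import all_boot all_order all_algebra.
From mathcomp Require Import all_classical all_reals all_analysis.
Import Order.TTheory GRing.Theory Num.Theory numFieldNormedType.Exports.

Set Implicit Arguments.
Unset Strict Implicit.
Unset Printing Implicit Defensive.

Local Open Scope classical_set_scope.
Local Open Scope ring_scope.

(** * Smooth maps between normed spaces *)

(* Class C^k on the open set U; for finite-dimensional V this is the usual
   notion (all iterated directional derivatives exist and are continuous). *)
Fixpoint Ck (R : realType) (V W : normedModType R) (k : nat) (U : set V)
    (f : V -> W) : Prop :=
  match k with
  | 0%N => forall x, U x -> {for x, continuous f}
  | k'.+1 => (forall x, U x -> differentiable f x) /\
             (forall v : V, Ck k' U (fun x => 'D_v f x))
  end.

Definition Cinfty (R : realType) (V W : normedModType R) (U : set V)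
    (f : V -> W) : Prop := forall k, Ck k U f.

(* Smoothness on an arbitrary subset: local existence of smooth extensions. *)
Definition smooth_on (R : realType) (V W : normedModType R) (A : set V)
    (f : V -> W) : Prop :=
  forall x, A x -> exists (U : set V) (g : V -> W),
    [/\ open U, U x, Cinfty U g & forall y, U y -> A y -> f y = g y].

(** * Manifolds *)

Record chart (R : realType) (n : nat) (X : topologicalType) := Chart {
  cdom : set X ;
  cmap :> X -> 'rV[R]_n ;
  cinv : 'rV[R]_n -> X ;
  cdom_open : open cdom ;
  cimg_open : open (cmap @` cdom) ;
  cmapK : {in cdom, cancel cmap cinv} ;
  cmap_cont : {within cdom, continuous cmap} ;
  cinv_cont : {within cmap @` cdom, continuous cinv} }.

(* Hausdorffness is not part of the record: it is required of the base of a
   Lie groupoid but not of its space of arrows. *)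
Record manifold (R : realType) (n : nat) := Manifold {
  carrier :> topologicalType ;
  carrier_second_countable : @second_countable carrier ;
  atlas : set (chart R n carrier) ;
  chart_at : carrier -> chart R n carrier ;
  chart_at_atlas : forall p, atlas (chart_at p) ;
  mem_chart_at : forall p, cdom (chart_at p) p ;
  atlas_compat : forall c d, atlas c -> atlas d ->
    smooth_on (c @` (cdom c `&` cdom d)) (fun y => d (cinv c y)) }.

Definition smooth_fun_on (R : realType) (n : nat) (X : manifold R n)
    (W : normedModType R) (A : set X) (f : X -> W) : Prop :=
  forall c, atlas c -> smooth_on (c @` (cdom c `&` A)) (fun y => f (cinv c y)).

Definition smooth_map (R : realType) (n m : nat) (X : manifold R n)
    (Y : manifold R m) (f : X -> Y) : Prop :=
  continuous f /\
  forall d, atlas d -> smooth_fun_on (f @^-1` cdom d) (fun p => d (f p)).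

(* Paths are total functions of which only the values on I matter. *)
Definition smooth_path_on (R : realType) (n : nat) (X : manifold R n)
    (I : set R) (gamma : R -> X) : Prop :=
  {within I, continuous gamma} /\
  forall d, atlas d ->
    smooth_on (I `&` gamma @^-1` cdom d) (fun u => d (gamma u)).

(** * Tangent vectors *)

(* A tangent vector at p is represented by its coordinates in the preferred
   chart at p. *)
Definition tangent (R : realType) (n : nat) (X : manifold R n) (p : X) :
  normedModType R := 'rV[R]_n.

Definition tcoord (R : realType) (n : nat) (X : manifold R n)
    (c : chart R n X) (p : X) (v : tangent p) : 'rV[R]_n :=
  'd (fun y => c (cinv (chart_at p) y)) (chart_at p p) v.

Definition tmap (R : realType) (n m : nat) (X : manifold R n)
    (Y : manifold R m) (f : X -> Y) (p : X) (v : tangent p) : tangent (f p) :=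
  'd (fun y => chart_at (f p) (f (cinv (chart_at p) y))) (chart_at p p) v.

Definition dirderiv (R : realType) (n : nat) (X : manifold R n) (f : X -> R)
    (p : X) (v : tangent p) : R :=
  'd (fun y => f (cinv (chart_at p) y)) (chart_at p p) v.

(* One-sided derivative at 0, so that paths defined on [0, e[ are allowed. *)
Definition has_rderiv0 (R : realType) (W : normedModType R) (h : R -> W)
    (v : W) : Prop :=
  (fun u : R => u^-1 *: (h u - h 0)) @ (0 : R)^'+ --> v.

Definition has_velocity0 (R : realType) (n : nat) (X : manifold R n)
    (gamma : R -> X) (p : X) (v : tangent p) : Prop :=
  gamma 0 = p /\ has_rderiv0 (fun u => chart_at p (gamma u)) v.

Definition tangent_to (R : realType) (n : nat) (X : manifold R n) (S : set X)
    (p : X) (v : tangent p) : Prop :=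
  exists (e : R) (gamma : R -> X),
    [/\ 0 < e, smooth_path_on `]- e, e[ gamma,
        (forall u, - e < u < e -> S (gamma u)) & has_velocity0 gamma v].

Definition submersion (R : realType) (n m : nat) (X : manifold R n)
    (Y : manifold R m) (f : X -> Y) : Prop :=
  smooth_map f /\
  forall (p : X) (w : tangent (f p)), exists v : tangent p, tmap f v = w.

(** * Lie groupoids *)

(* [gmul g h] is only meaningful when [src g = tgt h]; its smoothness is that
   of a map on the subset of composable pairs of G x G, expressed in charts. *)
Record lie_groupoid (R : realType) (n m : nat) (G : manifold R n)
    (M : manifold R m) := LieGroupoid {
  src : G -> M ;
  tgt : G -> M ;
  gunit : M -> G ;
  gmul : G -> G -> G ;
  ginv : G -> G ;
  base_hausdorff : hausdorff_space M ;
  src_mul : forall g h, src g = tgt h -> src (gmul g h) = src h ;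
  tgt_mul : forall g h, src g = tgt h -> tgt (gmul g h) = tgt g ;
  gmulA : forall g h k, src g = tgt h -> src h = tgt k ->
    gmul g (gmul h k) = gmul (gmul g h) k ;
  src_unit : forall x, src (gunit x) = x ;
  tgt_unit : forall x, tgt (gunit x) = x ;
  gmul1g : forall g, gmul (gunit (tgt g)) g = g ;
  gmulg1 : forall g, gmul g (gunit (src g)) = g ;
  src_inv : forall g, src (ginv g) = tgt g ;
  tgt_inv : forall g, tgt (ginv g) = src g ;
  gmulVg : forall g, gmul (ginv g) g = gunit (src g) ;
  gmulgV : forall g, gmul g (ginv g) = gunit (tgt g) ;
  src_submersion : submersion src ;
  tgt_submersion : submersion tgt ;
  gunit_smooth : smooth_map gunit ;
  ginv_smooth : smooth_map ginv ;
  gmul_cont : {within [set p : G * G | src p.1 = tgt p.2],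
                 continuous (fun p : G * G => gmul p.1 p.2)} ;
  gmul_smooth : forall c1 c2 d : chart R n G,
    atlas c1 -> atlas c2 -> atlas d ->
    smooth_on
      [set y : 'rV[R]_n * 'rV[R]_n | exists g h,
         [/\ cdom c1 g, cdom c2 h, src g = tgt h, cdom d (gmul g h) &
             y = (c1 g, c2 h)]]
      (fun y => d (gmul (cinv c1 y.1) (cinv c2 y.2))) }.

(** * The Lie algebroid *)

Definition algebroid_fiber (R : realType) (n m : nat) (G : manifold R n)
    (M : manifold R m) (Gr : lie_groupoid G M) (x : M) :
    set (tangent (gunit Gr x)) :=
  [set a | tangent_to (src Gr @^-1` [set x]) a].

Definition anchor (R : realType) (n m : nat) (G : manifold R n)
    (M : manifold R m) (Gr : lie_groupoid G M) (x : M)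
    (a : tangent (gunit Gr x)) : tangent (tgt Gr (gunit Gr x)) :=
  tmap (tgt Gr) a.

(* Sections of A, given as vector fields along the units of G, tangent to the
   s-fibers; smoothness is that of the coordinates in the charts of G. *)
Record algebroid_section (R : realType) (n m : nat) (G : manifold R n)
    (M : manifold R m) (Gr : lie_groupoid G M) := AlgebroidSection {
  asec :> forall x : M, tangent (gunit Gr x) ;
  asec_fiber : forall x, algebroid_fiber (asec x) ;
  asec_smooth : forall c : chart R n G, atlas c ->
    smooth_fun_on (gunit Gr @^-1` cdom c) (fun x => tcoord c (asec x)) }.

(** * Line bundles *)

Record local_frame (R : realType) (M : topologicalType)
    (L : M -> lmodType R) := LocalFrame {
  fdom : set M ;
  fvec :> forall x, L x }.

(* The coordinate of v in the basis e of a one-dimensional space. *)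
Definition coord1 (R : realType) (V : lmodType R) (e v : V) : R :=
  xget 0 [set c : R | v = c *: e].

(* A bundle of one-dimensional vector spaces with an atlas of local frames
   related by smooth transition functions. *)
Record line_bundle (R : realType) (m : nat) (M : manifold R m) :=
  LineBundle {
  fiber :> M -> lmodType R ;
  frames : set (local_frame fiber) ;
  frames_open : forall e, frames e -> open (fdom e) ;
  frames_neq0 : forall e x, frames e -> fdom e x -> e x != 0 ;
  frames_gen : forall e x, frames e -> fdom e x ->
    forall v : fiber x, exists c : R, v = c *: e x ;
  frames_cover : forall x, exists2 e, frames e & fdom e x ;
  frames_compat : forall e e', frames e -> frames e' ->
    smooth_fun_on (fdom e `&` fdom e')
      (fun x => coord1 (e' x) (e x) : R) }.

Definition smooth_section (R : realType) (m : nat) (M : manifold R m)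
    (L : line_bundle M) (tau : forall x, L x) : Prop :=
  forall e, frames e ->
    smooth_fun_on (fdom e) (fun x => coord1 (e x) (tau x) : R).

Definition trivializable (R : realType) (m : nat) (M : manifold R m)
    (L : line_bundle M) : Prop :=
  exists tau : forall x, L x, smooth_section tau /\ forall x, tau x != 0.

Definition transport (T : Type) (F : T -> Type) (x y : T) (e : x = y)
    (v : F x) : F y := eq_rect x F v y e.

(** * Representations of a Lie groupoid on a line bundle *)

Record representation (R : realType) (n m : nat) (G : manifold R n)
    (M : manifold R m) (Gr : lie_groupoid G M) (L : line_bundle M) :=
  Representation {
  rep :> forall g : G, L (src Gr g) -> L (tgt Gr g) ;
  rep_linear : forall g (a : R) (v w : L (src Gr g)),
    rep (a *: v + w) = a *: rep v + rep w ;
  rep_bij : forall g, bijective (@rep g) ;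
  rep_mul : forall g h (gh : src Gr g = tgt Gr h) (v : L (src Gr h)),
    rep (transport (F := fiber L) (esym (src_mul gh)) v) =
    transport (F := fiber L) (esym (tgt_mul gh))
      (rep (transport (F := fiber L) (esym gh) (rep v))) ;
  rep_smooth : forall e e', frames e -> frames e' ->
    smooth_fun_on (src Gr @^-1` fdom e `&` tgt Gr @^-1` fdom e')
      (fun g => coord1 (e' (tgt Gr g)) (rep (e (src Gr g))) : R) }.

Section VanEst.
Variables (R : realType) (n m : nat) (G : manifold R n) (M : manifold R m).
Variables (Gr : lie_groupoid G M) (L : line_bundle M).
Variables (Delta : representation Gr L) (sigma : forall x, L x).

Definition char_fun (g : G) : R :=
  coord1 (sigma (tgt Gr g)) (Delta g (sigma (src Gr g))).

(* The R-component of Delta_g (s(g), r) when L is identified with M x R by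
   means of sigma; its M-component is t(g). *)
Definition triv_rep (g : G) (r : R) : R :=
  coord1 (sigma (tgt Gr g)) (Delta g (r *: sigma (src Gr g))).

(* A tangent vector of M x R is a pair of tangent vectors, whence the two
   derivative conditions. *)
Definition is_nabla (f : M -> R) (x : M) (a : tangent (gunit Gr x)) (c : R) :
    Prop :=
  exists (e : R) (gamma : R -> G),
    [/\ 0 < e, smooth_path_on `[0, e[ gamma,
        (forall u, 0 <= u < e -> src Gr (gamma u) = x)
      & has_velocity0 gamma a] /\
    [/\ has_velocity0 (fun u => tgt Gr (gamma u)) (p := x) (anchor a)
      & has_rderiv0 (fun u => triv_rep (gamma u) (f x))
          (- dirderiv f (p := x) (anchor a) + c)].

Definition nabla_pt (f : M -> R) (x : M) (a : tangent (gunit Gr x)) : R :=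
  xget 0 [set c | is_nabla f a c].

Definition nabla (X : algebroid_section Gr) (tau : forall x, L x) (x : M) :
    L x :=
  nabla_pt (fun y => coord1 (sigma y) (tau y)) (X x) *: sigma x.

Definition theta (X : algebroid_section Gr) (x : M) : R :=
  coord1 (sigma x) (nabla X sigma x).

End VanEst.

(* The derivative of log psi only involves psi near the units, where it is
   positive for a 1-cochain psi. *)
Definition van_est (R : realType) (n m : nat) (G : manifold R n)
    (M : manifold R m) (Gr : lie_groupoid G M) (psi : G -> R)
    (X : algebroid_section Gr) (x : M) : R :=
  dirderiv (fun g => ln (psi g)) (X x).

(* Main.v *)
(** In the trivialization by sigma the section sigma is the constant function 1,
whose directional derivatives vanish, so nabla_a 1 is the one-sided derivative
of phi_sigma along any path in the s-fiber with velocity a.  By the chain rule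
this is d(phi_sigma)(a), whatever the path.  On the other hand phi_sigma is
multiplicative and nonvanishing, so it equals 1 at units, where therefore
d(log phi_sigma) = d(phi_sigma).  The chain rule needs phi_sigma to be
differentiable: in local frames e, e' around s(g) and t(g), phi_sigma is
(sigma/e)(s(g)) k(g) / (sigma/e')(t(g)) with k the matrix entry of Delta. *)

Require Import Defs.
From mathcomp Require Import all_boot all_order all_algebra.
From mathcomp Require Import all_classical all_reals all_analysis.
Import Order.TTheory GRing.Theory Num.Theory numFieldNormedType.Exports.
Set Implicit Arguments.
Unset Strict Implicit.
Unset Printing Implicit Defensive.
Local Open Scope classical_set_scope.
Local Open Scope ring_scope.

(** * Differentials and one-sided derivatives in normed spaces *)

Lemma near_eq_differentiable (R : realType) (V W : normedModType R)
    (f g : V -> W) (x : V) :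
  (\near x, f x = g x) -> differentiable g x -> differentiable f x.
Proof.
move=> fg dg; have fgx := nbhs_singleton fg.
have [dgc /eqaddoP dgo] := (diff_locallyP _ _).1 dg.
(* Agreement near [x] carries the first-order expansion of [g] over to [f]; uniqueness of the
   differential then identifies the linear parts. *)
have dfo : f \o shift x = cst (f x) + 'd g x +o_ 0 id.
  apply/eqaddoP => e e0; have := dgo e e0; apply: filter_app.
  have : \forall h \near 0, f (h + x) = g (h + x).
    have : \forall h \near x, f h = g h by exact: fg.
    by rewrite (near_shift 0 x) /= subr0.
  by apply: filterS => h fgh; rewrite /= !fctE /= fgh fgx.
have df : 'd f x = 'd g x :> (V -> W) by exact: diff_unique.
by apply/diff_locallyP; rewrite df.
Qed.

(** One-sided chain rule. With [q u] the difference quotient of [w], that of [F \o w] is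
    ['d F (w 0) (q u)] plus a remainder of size [o(w u - w 0) / u], which tends to 0 because [q]
    stays bounded. *)
Lemma has_rderiv0_comp (R : realType) (V W : normedModType R)
    (F : V -> W) (w : R -> V) (v : V) :
  differentiable F (w 0) -> has_rderiv0 w v ->
  has_rderiv0 (F \o w) ('d F (w 0) v).
Proof.
move=> dF; rewrite /has_rderiv0 => wv.
set q := (fun u : R => _) in wv.
have [dFc /eqaddoP dFo] := (diff_locallyP _ _).1 dF.
have w0 : (w u - w 0) @[u --> (0:R)^'+] --> (0 : V).
  have : (u *: q u) @[u --> (0:R)^'+] --> (0 : R) *: v.
    apply: cvgZ => //; apply: cvg_within.
  rewrite scale0r; apply: cvg_trans; apply: near_eq_cvg.
  near=> u; have u0 : u != 0.
    by rewrite gt_eqF//; near: u; exact: nbhs_right_gt.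
  by rewrite /q scalerA divff// scale1r.
have dq : 'd F (w 0) (q u) @[u --> (0:R)^'+] --> 'd F (w 0) v.
  exact: (cvg_comp _ _ wv (dFc v)).
rewrite -['d F (w 0) v]addr0.
suff r0 : (u^-1 *: (F (w u) - F (w 0) - 'd F (w 0) (w u - w 0)))
    @[u --> (0:R)^'+] --> (0 : W).
  apply: cvg_trans (cvgD dq r0); apply: near_eq_cvg; near=> u.
  by rewrite !fctE/= /q linearZ/= -scalerDr addrC subrK.
have bq : \forall u \near (0:R)^'+, `|q u| <= `|v| + 1.
  have /cvgrPdist_le /(_ _ ltr01) := wv; apply: filterS => u qu.
  rewrite -lerBlDl (le_trans _ qu)// distrC; exact: lerB_dist.
apply/cvgr0Pnorm_le => e e0.
have v1 : 0 < `|v| + 1 by rewrite ltr_wpDl.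
(* This tolerance is chosen so that its product with the bound on the norm of [q u] is exactly
   [e]. *)
have dFe : \forall u \near (0:R)^'+,
    `|F (w u) - F (w 0) - 'd F (w 0) (w u - w 0)|
    <= e / (`|v| + 1) * `|w u - w 0|.
  refine (@filterS _ (0:R)^'+ _ _ _ _ (w0 _ (dFo _ (divr_gt0 e0 v1)))) => u /=.
  by rewrite !fctE /= subrK opprD addrA.
near=> u.
have u0 : 0 < u by near: u; exact: nbhs_right_gt.
have Fe : `|F (w u) - F (w 0) - 'd F (w 0) (w u - w 0)|
    <= e / (`|v| + 1) * `|w u - w 0| by near: u.
rewrite normrZ gtr0_norm ?invr_gt0//.
rewrite mulrC ler_pdivrMr//; apply: (le_trans Fe).
have -> : w u - w 0 = u *: q u by rewrite /q scalerA divff ?gt_eqF// scale1r.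
rewrite normrZ gtr0_norm// mulrCA mulrC ler_pM2r//.
rewrite mulrAC ler_pdivrMr// ler_pM2l//.
by near: u.
Unshelve. all: by end_near. Qed.

(** At an interior point of [A] the local smooth extension agrees with [f] on a whole neighborhood,
    and its class C^1 makes it differentiable. *)
Lemma smooth_on_differentiable (R : realType) (V W : normedModType R)
    (A : set V) (f : V -> W) (x : V) :
  nbhs x A -> smooth_on A f -> differentiable f x.
Proof.
move=> Ax fA; have [U [g [Uo Ux gC fg]]] := fA x (nbhs_singleton Ax).
apply: (@near_eq_differentiable _ _ _ f g); last by have [+ _] := gC 1%N; apply.
near=> y; apply: fg; last by near: y.
by near: y; exact: open_nbhs_nbhs.
Unshelve. all: by end_near. Qed.

(** * Charts and differentiability on manifolds *)

Section Charts.
Variables (R : realType) (n : nat) (X : topologicalType).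

Lemma nbhs_cdom (c : chart R n X) (p : X) : cdom c p -> nbhs p (cdom c).
Proof. by move=> cp; apply: open_nbhs_nbhs; split => //; exact: cdom_open. Qed.

Lemma cinv_cvg (c : chart R n X) (p : X) :
  cdom c p -> cinv c y @[y --> c p] --> p.
Proof.
move=> cp; have := cinv_cont (c := c).
rewrite continuous_open_subspace; last exact: cimg_open.
move=> /(_ (c p)); rewrite inE => /(_ (imageP _ cp)).
by rewrite /continuous_at cmapK ?inE.
Qed.

(** Points near [c p] lie in the open image of [c], and continuity of [cinv c] sends them back into
    [A]. This supplies the interior points that [smooth_on_differentiable] asks for. *)
Lemma nbhs_cimg (c : chart R n X) (p : X) (A : set X) :
  cdom c p -> nbhs p A -> nbhs (c p) (c @` (cdom c `&` A)).
Proof.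
move=> cp Ap.
have img : nbhs (c p) (c @` cdom c).
  by apply: open_nbhs_nbhs; split; [exact: cimg_open|exact: imageP].
have Ainv := cinv_cvg cp Ap.
near=> y; have [z cz zy] : (c @` cdom c) y by near: y.
exists z => //; split=> //.
by rewrite -(cmapK (c := c) (x := z)) ?inE// zy; near: y.
Unshelve. all: by end_near. Qed.

End Charts.

Lemma smooth_fun_on_differentiable (R : realType) (n : nat) (X : manifold R n)
    (W : normedModType R) (A : set X)
    (f : X -> W) (c : chart R n X) (p : X) :
  atlas c -> cdom c p -> nbhs p A -> smooth_fun_on A f ->
  differentiable (fun y => f (cinv c y)) (c p).
Proof.
move=> ac cp Ap fA.
exact: smooth_on_differentiable (nbhs_cimg cp Ap) (fA c ac).
Qed.

Lemma smooth_map_differentiable (R : realType) (n m : nat)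
    (X : manifold R n) (Y : manifold R m) (f : X -> Y)
    (c : chart R n X) (d : chart R m Y) (p : X) :
  smooth_map f -> atlas c -> atlas d -> cdom c p -> cdom d (f p) ->
  differentiable (fun y => d (f (cinv c y))) (c p).
Proof.
move=> [fc fs] ac ad cp dfp.
apply: smooth_fun_on_differentiable (fs d ad) => //.
by apply: fc; exact: nbhs_cdom.
Qed.

(** Factor through the preferred chart [d] at [f p]: near [c p] the map [f \o cinv c] lands in
    [cdom d], where [cinv d] undoes [d]. *)
Lemma smooth_fun_on_comp_differentiable (R : realType) (n m : nat)
    (X : manifold R n) (Y : manifold R m) (W : normedModType R)
    (f : X -> Y) (B : set Y) (h : Y -> W) (c : chart R n X) (p : X) :
  smooth_map f -> atlas c -> cdom c p -> nbhs (f p) B -> smooth_fun_on B h ->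
  differentiable (fun y => h (f (cinv c y))) (c p).
Proof.
move=> fs ac cp Bfp hB; set d := chart_at (f p).
have ad : atlas d by exact: chart_at_atlas.
have dfp : cdom d (f p) by exact: mem_chart_at.
have df := smooth_map_differentiable fs ac ad cp dfp.
have dh := smooth_fun_on_differentiable ad dfp Bfp hB.
apply: (@near_eq_differentiable _ _ _ _
    ((fun z => h (cinv d z)) \o (fun y => d (f (cinv c y))))); last first.
  by apply: differentiable_comp => //=; rewrite cmapK ?inE.
have : nbhs (c p) ((f \o cinv c) @^-1` cdom d).
  exact: (cinv_cvg cp (fs.1 p _ (nbhs_cdom dfp))).
by apply: filterS => y dy /=; rewrite cmapK// inE.
Qed.

(** * Paths and their velocities *)

Section Paths.
Variables (R : realType) (n : nat) (X : manifold R n).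

Lemma smooth_path_on_cvg0 (gamma : R -> X) (e : R) :
  0 < e -> smooth_path_on `[0, e[ gamma ->
  gamma u @[u --> (0 : R)^'+] --> gamma 0.
Proof.
move=> e0 [/subspace_continuousP gc _].
have /gc : `[0, e[%classic (0 : R) by rewrite /= in_itv/= lexx.
move=> g0 P /g0 gP.
have {}gP : \forall u \near (0 : R), `[0, e[%classic u -> P (gamma u).
  exact: gP.
change (\forall u \near (0 : R)^'+, P (gamma u)).
near=> u; have : `[0, e[%classic u.
  rewrite /= in_itv/=; apply/andP; split; near: u.
    exact: nbhs_right_ge.
  exact: nbhs_right_lt.
by near: u; exact: (cvg_within _ gP).
Unshelve. all: by end_near. Qed.

(** Chain rule in the preferred chart. Convergence of [gamma] is a separate hypothesis because
    charts are total functions: a coordinate velocity alone does not keep [gamma] inside the chart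
    domain, where [F] can be read in coordinates. *)
Lemma has_velocity0_comp (W : normedModType R) (F : X -> W) (gamma : R -> X)
    (p : X) (v : tangent p) :
  gamma u @[u --> (0 : R)^'+] --> gamma 0 -> has_velocity0 gamma v ->
  differentiable (fun y => F (cinv (chart_at p) y)) (chart_at p p) ->
  has_rderiv0 (fun u => F (gamma u))
    ('d (fun y => F (cinv (chart_at p) y)) (chart_at p p) v).
Proof.
move=> gc [g0 gv] dF; rewrite g0 in gc.
have cp := mem_chart_at p.
have := @has_rderiv0_comp _ _ _ _ (fun u => chart_at p (gamma u)) v.
rewrite g0 => /(_ _ _ dF gv); apply: cvg_trans; apply: near_eq_cvg.
have : \forall u \near (0 : R)^'+, cdom (chart_at p) (gamma u).
  exact: (gc _ (nbhs_cdom cp)).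
by apply: filterS => u cu /=; rewrite g0 !cmapK ?inE.
Qed.

Lemma smooth_path_onW (I J : set R) (gamma : R -> X) :
  J `<=` I -> smooth_path_on I gamma -> smooth_path_on J gamma.
Proof.
move=> JI [gc gs]; split; first exact: continuous_subspaceW gc.
move=> d ad u [/JI Iu du]; have [U [g [Uo Uu gC gE]]] := gs d ad u (conj Iu du).
by exists U, g; split => // y Uy [/JI Iy dy]; exact: gE.
Qed.

End Paths.

Lemma has_rderiv0_unique (R : realType) (W : normedModType R) (h : R -> W)
    (v w : W) : has_rderiv0 h v -> has_rderiv0 h w -> v = w.
Proof. exact: cvg_unique. Qed.

(** * Coordinates along a nonzero vector *)

Lemma scalerIr (R : fieldType) (V : lmodType R) (e : V) :
  e != 0 -> injective (fun c : R => c *: e).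
Proof.
move=> e0 c d /eqP; rewrite -subr_eq0 -scalerBl scaler_eq0 (negPf e0) orbF.
by rewrite subr_eq0 => /eqP.
Qed.

Lemma coord1Z (R : realType) (V : lmodType R) (e : V) (c : R) :
  e != 0 -> coord1 e (c *: e) = c.
Proof. by move=> e0; apply: xget_unique => //= d /(scalerIr e0). Qed.

Lemma coord1E (R : realType) (V : lmodType R) (e v : V) :
  (exists c : R, v = c *: e) -> v = coord1 e v *: e.
Proof. by move=> ev; rewrite /coord1; exact: (xgetPex 0 ev). Qed.

(** Along a global section, transport only moves the base point; this clears the transports in
    [rep_mul]. *)
Lemma transportZ (R : realType) (T : Type) (F : T -> lmodType R)
    (s : forall x, F x) (x y : T) (e : x = y) (c : R) :
  transport (F := F) e (c *: s x) = c *: s y.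
Proof. by case: _ / e. Qed.

Lemma dirderiv_cst (R : realType) (n : nat) (X : manifold R n) (r : R) (p : X)
    (v : tangent p) : dirderiv (fun=> r) v = 0.
Proof. by rewrite /dirderiv (diff_cst r). Qed.

(** * The characteristic function: multiplicativity and differentiability *)

Section CharFun.
Variables (R : realType) (n m : nat) (G : manifold R n) (M : manifold R m).
Variables (Gr : lie_groupoid G M) (L : line_bundle M).
Variables (Delta : representation Gr L) (sigma : forall x : M, L x).
Hypothesis sigma_smooth : smooth_section sigma.
Hypothesis sigma_neq0 : forall x : M, sigma x != 0.

(** In a local frame [e], [sigma x] is a nonzero multiple of [e x], so it spans the same line. *)
Lemma section_gen (x : M) (v : L x) : v = coord1 (sigma x) v *: sigma x.
Proof.
apply: coord1E; have [e fe ex] := frames_cover L x.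
have [c vE] := frames_gen fe ex v; have [d sE] := frames_gen fe ex (sigma x).
have d0 : d != 0.
  by apply: contraNneq (sigma_neq0 x) => d0; rewrite sE d0 scale0r.
by exists (c / d); rewrite sE scalerA divfK.
Qed.

Lemma rep0 (g : G) : Delta g 0 = 0.
Proof.
have := rep_linear Delta (g := g) 1 0 0; rewrite !scale1r addr0 => /esym/eqP.
by rewrite -subr_eq0 addrK => /eqP.
Qed.

Lemma repZ (g : G) (a : R) (v : L (src Gr g)) :
  Delta g (a *: v) = a *: Delta g v.
Proof. by rewrite -[a *: v]addr0 rep_linear rep0 addr0. Qed.

Lemma char_funE (g : G) :
  Delta g (sigma (src Gr g)) = char_fun Delta sigma g *: sigma (tgt Gr g).
Proof. exact: section_gen. Qed.

(** A zero value would make the injective map [Delta g] kill a nonzero vector. *)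
Lemma char_fun_neq0 (g : G) : char_fun Delta sigma g != 0.
Proof.
apply: contraNneq (sigma_neq0 (src Gr g)) => g0.
apply/eqP/(bij_inj (rep_bij Delta g)).
by rewrite char_funE g0 scale0r rep0.
Qed.

Lemma char_fun_mul (g h : G) : src Gr g = tgt Gr h ->
  char_fun Delta sigma (gmul Gr g h) =
  char_fun Delta sigma g * char_fun Delta sigma h.
Proof.
move=> gh; have := rep_mul Delta gh (sigma (src Gr h)).
rewrite char_funE transportZ repZ char_funE scalerA.
(* The factor 1 puts the bare value of [sigma] into the form that [transportZ] expects. *)
rewrite transportZ -[sigma (src Gr h)]scale1r transportZ scale1r char_funE.
by move/(scalerIr (sigma_neq0 _)); rewrite mulrC.
Qed.

(** A unit is idempotent, so its value is a nonzero solution of [t * t = t]. *)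
Lemma char_fun_unit (x : M) : char_fun Delta sigma (gunit Gr x) = 1.
Proof.
have := gmul1g Gr (gunit Gr x); rewrite tgt_unit.
move/(congr1 (char_fun Delta sigma)).
rewrite char_fun_mul; last by rewrite src_unit tgt_unit.
by rewrite -[RHS]mul1r => /(mulIf (char_fun_neq0 _)).
Qed.

Lemma char_fun_frame (e e' : local_frame L) (g : G) :
  frames e -> frames e' -> fdom e (src Gr g) -> fdom e' (tgt Gr g) ->
  char_fun Delta sigma g =
  coord1 (e (src Gr g)) (sigma (src Gr g)) *
  coord1 (e' (tgt Gr g)) (Delta g (e (src Gr g))) /
  coord1 (e' (tgt Gr g)) (sigma (tgt Gr g)).
Proof.
move=> fe fe' es e't.
set a := coord1 _ (sigma (src Gr g)); set k := coord1 _ (Delta _ _).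
set b := coord1 _ (sigma (tgt Gr g)).
have aE : sigma (src Gr g) = a *: e (src Gr g) by exact/coord1E/frames_gen.
have kE : Delta g (e (src Gr g)) = k *: e' (tgt Gr g).
  exact/coord1E/frames_gen.
have bE : sigma (tgt Gr g) = b *: e' (tgt Gr g) by exact/coord1E/frames_gen.
have b0 : b != 0.
  by apply: contraNneq (sigma_neq0 (tgt Gr g)) => b0; rewrite bE b0 scale0r.
rewrite /char_fun -[RHS](coord1Z _ (sigma_neq0 (tgt Gr g))); congr coord1.
by rewrite {1}aE repZ kE scalerA [in RHS]bE scalerA divfK.
Qed.

Lemma char_fun_differentiable (c : chart R n G) (g : G) :
  atlas c -> cdom c g ->
  differentiable (fun y => char_fun Delta sigma (cinv c y)) (c g).
Proof.
move=> ac cg.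
have [e fe es] := frames_cover L (src Gr g).
have [e' fe' e't] := frames_cover L (tgt Gr g).
pose A := src Gr @^-1` fdom e `&` tgt Gr @^-1` fdom e'.
have nes : nbhs (src Gr g) (fdom e).
  by apply: open_nbhs_nbhs; split => //; exact: frames_open fe.
have net : nbhs (tgt Gr g) (fdom e').
  by apply: open_nbhs_nbhs; split => //; exact: frames_open fe'.
have [ssm _] := src_submersion Gr; have [tsm _] := tgt_submersion Gr.
have nA : nbhs g A by apply: filterI; [exact: ssm.1|exact: tsm.1].
pose a (y : 'rV[R]_n) : R :=
  coord1 (e (src Gr (cinv c y))) (sigma (src Gr (cinv c y))).
pose k (y : 'rV[R]_n) : R :=
  coord1 (e' (tgt Gr (cinv c y))) (Delta (cinv c y) (e (src Gr (cinv c y)))).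
pose b (y : 'rV[R]_n) : R :=
  coord1 (e' (tgt Gr (cinv c y))) (sigma (tgt Gr (cinv c y))).
have da : differentiable a (c g).
  exact: (smooth_fun_on_comp_differentiable ssm ac cg nes (sigma_smooth fe)).
have dk : differentiable k (c g).
  exact: (smooth_fun_on_differentiable ac cg nA (rep_smooth Delta fe fe')).
have db : differentiable b (c g).
  exact: (smooth_fun_on_comp_differentiable tsm ac cg net (sigma_smooth fe')).
have b0 : b (c g) != 0.
  rewrite /b cmapK ?inE//; apply: contraNneq (sigma_neq0 (tgt Gr g)) => b0.
  by rewrite (coord1E (frames_gen fe' e't (sigma _))) b0 scale0r.
(* Over [A] both frames are available, so the frame formula holds on a neighborhood of [c g]. *)
apply: (@near_eq_differentiable _ _ _ _ (a * k * (fun y => (b y)^-1))).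
  have : nbhs (c g) (cinv c @^-1` A) by exact: cinv_cvg.
  by apply: filterS => y [ys yt]; exact: char_fun_frame.
by apply: differentiableM; [exact: differentiableM|exact: differentiableV].
Qed.

(** * Derivatives of the characteristic function at units *)

Lemma van_est_char_fun (X : algebroid_section Gr) (x : M) :
  van_est (char_fun Delta sigma) X x =
  dirderiv (char_fun Delta sigma) (X x).
Proof.
rewrite /van_est /dirderiv; set p := gunit Gr x; set c := chart_at p.
have dphi : differentiable (fun y => char_fun Delta sigma (cinv c y)) (c p).
  by apply: char_fun_differentiable; [exact: chart_at_atlas|exact: mem_chart_at].
have phi1 : char_fun Delta sigma (cinv c (c p)) = 1.
  by rewrite cmapK ?char_fun_unit// inE; exact: mem_chart_at.
have dln1 : is_derive (1 : R) (1 : R) (@ln R) 1.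
  by have := is_derive1_ln (@ltr01 R); rewrite invr1.
have dln : differentiable (@ln R) (char_fun Delta sigma (cinv c (c p))).
  by rewrite phi1; apply/derivable1_diffP.
(* Chain rule for [ln], whose derivative at the value 1 taken on units is 1. *)
rewrite (diff_comp (g := @ln R) dphi dln) /= phi1 diff1E; last by rewrite -phi1.
by rewrite derive1E derive_val scaler1.
Qed.

Lemma char_fun_rderiv0 (gamma : R -> G) (e : R) (x : M)
    (a : tangent (gunit Gr x)) :
  0 < e -> smooth_path_on `[0, e[ gamma -> has_velocity0 gamma a ->
  has_rderiv0 (fun u => triv_rep Delta sigma (gamma u) 1)
    (dirderiv (char_fun Delta sigma) a).
Proof.
move=> e0 gs ga.
have -> : (fun u => triv_rep Delta sigma (gamma u) 1) =
    (fun u => char_fun Delta sigma (gamma u)).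
  by apply/funext => u; rewrite /triv_rep scale1r.
apply: has_velocity0_comp ga _; first exact: smooth_path_on_cvg0 gs.
apply: char_fun_differentiable => //; first exact: chart_at_atlas.
exact: mem_chart_at.
Qed.

(** The choice in [nabla_pt] calls for existence and uniqueness. The path witnessing
    [algebroid_fiber a] gives existence; uniqueness holds because, by [char_fun_rderiv0], every
    admissible path yields the same derivative. *)
Lemma nabla_pt1 (x : M) (a : tangent (gunit Gr x)) :
  algebroid_fiber a ->
  nabla_pt Delta sigma (fun=> 1) a = dirderiv (char_fun Delta sigma) a.
Proof.
move=> [e [gamma [e0 gs gx ga]]]; apply: xget_unique; last first.
  move=> c [e' [delta [[e'0 ds dx da] [_]]]].
  rewrite dirderiv_cst oppr0 add0r => dc.
  exact: has_rderiv0_unique dc (char_fun_rderiv0 e'0 ds da).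
(* The witnessing path is two-sided, whereas [is_nabla] asks for one on nonnegative times. *)
have gs0 : smooth_path_on `[0, e[ gamma.
  apply: smooth_path_onW gs => u /=; rewrite !in_itv/= => /andP[u0 ue].
  by rewrite ue andbT (lt_le_trans _ u0)// oppr_lt0.
have g0 := ga.1.
exists e, gamma; split; split => //.
- move=> u /andP[u0 ue]; apply: gx.
  by rewrite ue andbT (lt_le_trans _ u0)// oppr_lt0.
- split; first by rewrite g0 tgt_unit.
  (* Writing the base point as the target of its unit makes the chart agree with the one used by
     [tmap] in [anchor]. *)
  rewrite -{1}(tgt_unit Gr x).
  set d := chart_at (tgt Gr (gunit Gr x)).
  apply: (has_velocity0_comp (F := fun g => d (tgt Gr g))) ga _.
    exact: smooth_path_on_cvg0 gs0.
  apply: smooth_map_differentiable; first exact: (tgt_submersion Gr).1.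
  + exact: chart_at_atlas.
  + exact: chart_at_atlas.
  + exact: mem_chart_at.
  + exact: mem_chart_at.
- by rewrite dirderiv_cst oppr0 add0r; exact: char_fun_rderiv0 gs0 ga.
Qed.

End CharFun.

Theorem theorem4p1 (R : realType) (n m : nat)
    (G : manifold R n) (M : manifold R m) (Gr : lie_groupoid G M)
    (L : line_bundle M) (Delta : representation Gr L)
    (hL : trivializable L)
    (sigma : forall x : M, L x)
    (sigma_smooth : smooth_section sigma)
    (sigma_neq0 : forall x : M, sigma x != 0) :
  van_est (Gr := Gr) (char_fun Delta sigma) = theta Delta sigma.
Proof.
apply/funext => X; apply/funext => x.
rewrite van_est_char_fun // /theta /nabla coord1Z//.
have -> : (fun y => coord1 (sigma y) (sigma y)) = (fun=> 1).
  by apply/funext => y; rewrite -[X in coord1 _ X]scale1r coord1Z.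
by rewrite nabla_pt1 //; exact: asec_fiber.
Qed.
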